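(* For every partition $\mu$, the insertion process $\psi_\mu$ described below always terminates, and it is a weight-preserving bijection $$\psi_\mu \colon \mathcal B(\mu) \times \{x_1,y_1,x_2,y_2,\ldots\} \longrightarrow \bigcup_{\nu \colon \mu \lessdot \nu} \mathcal B(\nu),$$ where the weight of a pair $(T,z)$ is $w(T)\,z$ and the weight of a tableau in the target is $w$.
   Context: Partitions are extended by zeros ($\mu_i=0$ for $i>\ell(\mu)$), $\mu'$ is the conjugate partition, $[\mu]=\{(i,j): i\ge1, 1\le j\le\mu_i\}$, and $\mu\lessdot\nu$ means $[\mu]\subseteq[\nu]$ with $|\nu|=|\mu|+1$. An outer corner of $\mu$ is a cell $(i,j)\notin[\mu]$ with ($i=1$ or $(i-1,j)\in[\mu]$) and ($j=1$ or $(i,j-1)\in[\mu]$). A bicolored tableau of shape $\mu$ is a map $T:[\mu]\to\mathbb{Z}_{\ge0}$, $(i,j)\mapsto T_{ij}$, whose values are weakly increasing along rows and down columns, together with a color (black or red) assigned to each entry; $\mathcal B(\mu)$ is the set of bicolored tableaux of shape $\mu$. With $x_1,x_2,\dots,y_1,y_2,\dots$ commuting indeterminates, the variable represented by the entry in cell $(i,j)$ is $x_{i+T_{ij}}$ if it is black and $y_{j+T_{ij}}$ if it is red, and the weight $w(T)$ is the product of the variables represented by all entries. Insertion process $\psi_\mu(T,z)$: start with $i=j=0$, $w=z$, $S=T$. Repeat: if $w=x_k$, increase $j$ by $1$ and choose the largest $i$ (allowed values are $1\le i\le\mu'_j$, and also $i=\mu'_j+1$ if $j=1$ or $\mu'_j<\mu'_{j-1}$)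 such that putting a black entry $k-i$ in position $(i,j)$ (replacing $S_{ij}$ if present) leaves column $j$ consisting of non-negative integers weakly increasing downward; if $w=y_k$, increase $i$ by $1$ and choose the largest $j$ (allowed values $1\le j\le\mu_i$, and also $j=\mu_i+1$ if $i=1$ or $\mu_i<\mu_{i-1}$) such that putting a red entry $k-j$ in position $(i,j)$ leaves row $i$ consisting of non-negative integers weakly increasing to the right. Place that entry; if $(i,j)\in[\mu]$, let the new $w$ be the variable represented by the old entry $S_{ij}$ that was replaced and repeat; if $(i,j)$ is an outer corner of $\mu$, stop and output the resulting tableau $S$, denoted $\psi_\mu(T,z)$. *)

(* Defs.v *)
From HB Require Import structures.
From mathcomp Require Import all_boot finmap.
From mathcomp Require Import boolp classical_sets functions.
From mathcomp.multinomials Require monalg.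

Set Implicit Arguments.
Unset Strict Implicit.
Unset Printing Implicit Defensive.

Local Open Scope fset_scope.
Local Open Scope fmap_scope.
Local Open Scope nat_scope.
Local Open Scope classical_set_scope.

Definition is_part (mu : seq nat) : bool := sorted geq mu && (0 \notin mu).

(* Rows and columns are numbered from 1: [part mu i] is $\mu_i$ and
   [conj_part mu j] is $\mu'_j$, both meaningful for positive indices only. *)
Definition part (mu : seq nat) (i : nat) : nat := nth 0 mu i.-1.
Definition conj_part (mu : seq nat) (j : nat) : nat :=
  count (fun r => j <= r) mu.

(* (row, column) *)
Definition cell : Type := (nat * nat)%type.

Definition in_diagram (mu : seq nat) (c : cell) : bool :=
  (1 <= c.1) && (1 <= c.2 <= part mu c.1).

Definition covered_by (mu nu : seq nat) : Prop :=
  (forall c, in_diagram mu c -> in_diagram nu c) /\ sumn nu = (sumn mu).+1.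

Definition outer_corner (mu : seq nat) (c : cell) : bool :=
  [&& 1 <= c.1, 1 <= c.2, ~~ in_diagram mu c,
      (c.1 == 1) || in_diagram mu (c.1.-1, c.2) &
      (c.2 == 1) || in_diagram mu (c.1, c.2.-1)].

Inductive color := Black | Red.

(* [X k] is $x_k$ and [Y k] is $y_k$; only the indices $k \ge 1$ are genuine
   indeterminates, see [indeterminates]. *)
Inductive variable := X of nat | Y of nat.

Definition sum_of_variable (z : variable) : nat + nat :=
  match z with X k => inl k | Y k => inr k end.
Definition variable_of_sum (s : nat + nat) : variable :=
  match s with inl k => X k | inr k => Y k end.
Lemma sum_of_variableK : cancel sum_of_variable variable_of_sum.
Proof. by case. Qed.
HB.instance Definition _ := Countable.copy variable (can_type sum_of_variableK).

Definition indeterminates : set variable :=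
  [set z | match z with X k => 1 <= k | Y k => 1 <= k end].

Definition entry : Type := (nat * color)%type.

(* A finite partial filling of the cells; it is a tableau of shape [mu] when
   [bicolored mu] below holds, which forces its domain to be $[\mu]$. *)
Definition filling : Type := {fmap cell -> entry}.

Definition row_incr (S : filling) (i : nat) : Prop :=
  forall j1 j2 e1 e2, S.[? (i, j1)] = Some e1 -> S.[? (i, j2)] = Some e2 ->
    j1 <= j2 -> e1.1 <= e2.1.
Definition col_incr (S : filling) (j : nat) : Prop :=
  forall i1 i2 e1 e2, S.[? (i1, j)] = Some e1 -> S.[? (i2, j)] = Some e2 ->
    i1 <= i2 -> e1.1 <= e2.1.

Definition bicolored (mu : seq nat) : set filling :=
  [set T | [/\ forall c, (c \in domf T) = in_diagram mu c,
               forall i, row_incr T i & forall j, col_incr T j]].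

Definition represents (c : cell) (e : entry) : variable :=
  match e.2 with Black => X (c.1 + e.1) | Red => Y (c.2 + e.1) end.

(* Monomials in commuting indeterminates are elements of the free commutative
   monoid [monalg.cmonom variable]. *)
Definition monomial : Type := monalg.cmonom variable.
Definition mono_var (z : variable) : monomial := monalg.ucm z.
Definition mono_mul (m1 m2 : monomial) : monomial := monalg.mulcm m1 m2.
Definition mono_one : monomial := monalg.onecm variable.

Definition weight (T : filling) : monomial :=
  \big[mono_mul/mono_one]_(c : domf T) mono_var (represents (val c) (T c)).

(* The truncated subtractions [k - i], [k - j] below are exact thanks to the
   conjuncts [i <= k], [j <= k], which say that the new entry is
   non-negative. *)
Definition put_black (S : filling) (k : nat) (c : cell) : filling :=
  S.[c <- (k - c.1, Black)].
Definition put_red (S : filling) (k : nat) (c : cell) : filling :=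
  S.[c <- (k - c.2, Red)].

Definition black_fits (mu : seq nat) (S : filling) (k j i : nat) : Prop :=
  [/\ 1 <= i <= conj_part mu j \/
        i = (conj_part mu j).+1 /\
        (j = 1 \/ conj_part mu j < conj_part mu j.-1),
      i <= k & col_incr (put_black S k (i, j)) j].

Definition red_fits (mu : seq nat) (S : filling) (k i j : nat) : Prop :=
  [/\ 1 <= j <= part mu i \/
        j = (part mu i).+1 /\ (i = 1 \/ part mu i < part mu i.-1),
      j <= k & row_incr (put_red S k (i, j)) i].

Definition is_largest (P : nat -> Prop) (m : nat) : Prop :=
  P m /\ forall m', P m' -> m' <= m.

(* The loop variables: current position $(i,j)$, pending variable $w$ and
   current filling $S$. *)
Record state := State { pos : cell; pending : variable; current : filling }.

Definition initial (T : filling) (z : variable) : state := State (0, 0) z T.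

(* [places mu s c S']: the pass of the loop started in state [s] moves to
   position [c] and writes the new entry there, giving the filling [S']. *)
Inductive places (mu : seq nat) : state -> cell -> filling -> Prop :=
| places_X i0 j0 k S i :
    is_largest (black_fits mu S k j0.+1) i ->
    places mu (State (i0, j0) (X k) S) (i, j0.+1) (put_black S k (i, j0.+1))
| places_Y i0 j0 k S j :
    is_largest (red_fits mu S k i0.+1) j ->
    places mu (State (i0, j0) (Y k) S) (i0.+1, j) (put_red S k (i0.+1, j)).

Inductive continues (mu : seq nat) (s : state) : state -> Prop :=
| Continues c S' e :
    places mu s c S' -> in_diagram mu c -> (current s).[? c] = Some e ->
    continues mu s (State c (represents c e) S').

Inductive stops (mu : seq nat) (s : state) : filling -> Prop :=
| Stops c S' : places mu s c S' -> outer_corner mu c -> stops mu s S'.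

(* Every execution from [s] is finite and never blocks before stopping. *)
Inductive terminates (mu : seq nat) (s : state) : Prop :=
| Terminates :
    (exists s', continues mu s s') \/ (exists S', stops mu s S') ->
    (forall s', continues mu s s' -> terminates mu s') ->
    terminates mu s.

Inductive outputs (mu : seq nat) : state -> filling -> Prop :=
| outputs_stop s S' : stops mu s S' -> outputs mu s S'
| outputs_continue s s' S' :
    continues mu s s' -> outputs mu s' S' -> outputs mu s S'.

(* Main.v *)
(** A black entry displaced from cell (i, j) is inserted in column j + 1 weakly
    above row i, a red one in row i + 1 weakly left of column j, always at a
    value not larger than the one it replaces; hence the filling stays a tableau
    throughout. A step is recovered from its result: the color of the entry just
    written tells which kind of insertion took place, and the cell it was
    displaced from is the only one in the previous line to which the variable can
    be returned without breaking monotonicity. A step does not increase the sum of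
    the entries, and while that sum is constant the displaced value, and then the
    position, strictly increase lexicographically. All variable indices stay
    bounded, so both the process and its reversal terminate: forwards at an outer
    corner, backwards at an initial state. *)

Require Import Defs.
From HB Require Import structures.
From Stdlib Require Import Relation_Operators Operators_Properties.
From mathcomp Require Import all_boot finmap.
From mathcomp Require Import boolp classical_sets functions.
From mathcomp.multinomials Require monalg.
From mathcomp Require Import zify.

Set Implicit Arguments.
Unset Strict Implicit.
Unset Printing Implicit Defensive.

Local Open Scope fset_scope.
Local Open Scope fmap_scope.
Local Open Scope nat_scope.
Local Open Scope classical_set_scope.

Implicit Types (mu nu : seq nat) (b : color) (c : cell) (e : entry).
Implicit Types (S T : filling) (s : state).

(** * Partitions and diagrams *)

Lemma leq_nth_part mu (i j : nat) :
  is_part mu -> i <= j -> nth 0 mu j <= nth 0 mu i.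
Proof.
case/andP=> mu_sorted _ le_ij.
have [lt_j | ge_j] := ltnP j (size mu); last by rewrite nth_default.
have geq_trans : transitive geq.
  by move=> y x z /= le_yx le_zy; apply: leq_trans le_zy le_yx.
by apply: (sorted_leq_nth geq_trans leqnn 0 mu_sorted) => //; rewrite inE; lia.
Qed.

Lemma nth_part_gt0 mu (i : nat) : is_part mu -> (0 < nth 0 mu i) = (i < size mu).
Proof.
case/andP=> _ mu0; have [lt_i | ge_i] := ltnP i (size mu).
  by rewrite lt0n; apply: contra mu0 => /eqP <-; apply: mem_nth.
by rewrite nth_default.
Qed.

Lemma is_partI mu :
  (forall i, nth 0 mu i.+1 <= nth 0 mu i) ->
  (forall i, i < size mu -> 0 < nth 0 mu i) -> is_part mu.
Proof.
move=> mu_decr mu_gt0; apply/andP; split.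
  by apply/(sortedP 0) => i _; apply: mu_decr.
by apply/negP=> /(nthP 0)[i /mu_gt0]; case: (nth _ _ _).
Qed.

(** In the induction on rows, a first row shorter than [j] makes every row shorter than [j], so the
    count vanishes. *)
Lemma leq_conj_part mu (i j : nat) :
  is_part mu -> 0 < i -> 0 < j -> (i <= conj_part mu j) = (j <= part mu i).
Proof.
case/andP=> + _; rewrite /conj_part /part; case: i => // i + _ j_gt0 /=.
elim: mu i => [|m mu IH] i /= mu_sorted; first by rewrite nth_nil; lia.
have mu_le : all (geq m) mu.
  apply: order_path_min mu_sorted.
  by move=> y x z /= le_yx le_zy; apply: leq_trans le_zy le_yx.
case: (leqP j m) => [le_jm | lt_mj].
  by case: i => [|i] /=; rewrite add1n ltnS // IH // (path_sorted mu_sorted).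
have -> : count (fun r => j <= r) mu = 0.
  apply/eqP; rewrite -leqn0 leqNgt -has_count; apply/hasPn=> r /(allP mu_le) /=.
  by lia.
case: i => [|i] /=; first by lia.
have [lt_i | ge_i] := ltnP i (size mu); last by rewrite nth_default //; lia.
by have /(allP mu_le) /= := mem_nth 0 lt_i; lia.
Qed.

Lemma in_diagram_sub mu (i j i' j' : nat) :
  is_part mu -> in_diagram mu (i', j') -> 0 < i <= i' -> 0 < j <= j' ->
  in_diagram mu (i, j).
Proof.
rewrite /in_diagram /part /= => mu_part dgm' le_i le_j.
have := @leq_nth_part mu i.-1 i'.-1 mu_part; lia.
Qed.

Lemma in_diagram_bound mu c : is_part mu -> in_diagram mu c ->
  c.1 + c.2 <= size mu + sumn mu.
Proof.
rewrite /in_diagram /part => mu_part /and3P[c1 c2 c_le].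
have := nth_part_gt0 c.1.-1 mu_part.
suff : nth 0 mu c.1.-1 <= sumn mu by lia.
elim: {mu_part c_le}mu c.1.-1 => [|m mu IH] [|i] //=; first exact: leq_addr.
exact: leq_trans (IH i) (leq_addl _ _).
Qed.

(** * Covers of partitions and outer corners *)

Lemma sumn_nth mu (n : nat) : size mu <= n -> sumn mu = \sum_(i < n) nth 0 mu i.
Proof.
move=> le_n; rewrite sumnE (big_nth 0) big_mkord (big_ord_widen n (nth 0 mu)) //.
rewrite big_mkcond; apply: eq_bigr => i _.
by case: ltnP => // ge_i; rewrite nth_default.
Qed.

(** The row lengths grow by nonnegative amounts of sum 1, so exactly one row grows, by one cell; it
    is an outer corner because [nu] is again a partition. *)
Lemma cover_outer_corner mu nu : is_part mu -> is_part nu -> covered_by mu nu ->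
  exists2 c, outer_corner mu c &
    forall c', in_diagram nu c' = in_diagram mu c' || (c' == c).
Proof.
move=> mu_part nu_part [sub_dgm sum_nu].
have le_nth i : nth 0 mu i <= nth 0 nu i.
  case mu_i : (nth 0 mu i) => [//|m].
  by have := sub_dgm (i.+1, m.+1); rewrite /in_diagram /part /= mu_i; lia.
pose n := size mu + size nu.
have sum_diff : \sum_(i < n) (nth 0 nu i - nth 0 mu i) = 1.
  rewrite sumnB => [|i _]; last exact: le_nth.
  by rewrite -!sumn_nth ?sum_nu ?leq_addl ?leq_addr //; lia.
have [i lt_i] : exists i : 'I_n, nth 0 mu i < nth 0 nu i.
  apply/not_existsP => nlt; move: sum_diff; rewrite big1 // => i _.
  by have := nlt i; lia.
rewrite (bigD1 i) //= in sum_diff.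
have eq_i : nth 0 nu i = (nth 0 mu i).+1 by lia.
have eq_nth (j : nat) : j != i :> nat -> nth 0 nu j = nth 0 mu j.
  move=> ne_ji; have [lt_jn | ge_jn] := ltnP j n; last first.
    by rewrite !nth_default // (leq_trans _ ge_jn) // ?leq_addl ?leq_addr.
  move: sum_diff; rewrite (bigD1 (Ordinal lt_jn)) //=.
  by have := le_nth j; lia.
exists (i.+1, (nth 0 mu i).+1).
  rewrite /outer_corner /in_diagram /part /= ltnn /=.
  apply/andP; split.
    have [-> // | i_gt0] := posnP i.
    have := @leq_nth_part nu i.-1 i nu_part (leq_pred _).
    by rewrite eq_i eq_nth; lia.
  by have [-> // | ] := posnP (nth 0 mu i); lia.
move=> [i' j']; rewrite /in_diagram /part /= xpair_eqE /=.
case: i' => [//|i'] /=; rewrite eqSS.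
have [-> | ne_i'] := eqVneq i' i; first by rewrite eq_i; lia.
by rewrite eq_nth //; lia.
Qed.

(** Lengthening the row of the corner by one gives [nu]; the condition on the cell above keeps the
    row lengths weakly decreasing. *)
Lemma outer_corner_cover mu c : is_part mu -> outer_corner mu c ->
  exists nu, [/\ is_part nu, covered_by mu nu &
    forall c', in_diagram nu c' = in_diagram mu c' || (c' == c)].
Proof.
case: c => [[|i] j] // mu_part /and5P[_ j_gt0 c_out up left].
move: c_out up left; rewrite {1 2 3}/in_diagram /part /= => c_out up left.
have size_i := nth_part_gt0 i mu_part.
have size_i1 := nth_part_gt0 i.-1 mu_part.
have j_eq : j = (nth 0 mu i).+1 by lia.
have dgm c' : in_diagram (incr_nth mu i) c' = in_diagram mu c' || (c' == (i.+1, j)).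
  case: c' => [[|i'] j'] //; rewrite /in_diagram /part /= nth_incr_nth xpair_eqE eqSS.
  by have [<- | ] := eqVneq i i'; lia.
exists (incr_nth mu i); split=> //.
  apply: is_partI => i'; rewrite ?size_incr_nth !nth_incr_nth.
    have := @leq_nth_part mu i' i'.+1 mu_part (leqnSn _).
    have [<- | _] := eqVneq i i'; first by lia.
    have [i_eq | _] := eqVneq i i'.+1; last by lia.
    by move: up; rewrite i_eq /= in j_eq *; lia.
  have := nth_part_gt0 i' mu_part.
  by case: eqVneq => [//|ne]; case: (ltnP i (size mu)); lia.
split=> [c' c'_mu | ]; first by rewrite dgm c'_mu.
have -> : sumn (incr_nth mu i) = \sum_(i' < (size mu + i).+1) ((i == i') + nth 0 mu i').
  rewrite (@sumn_nth _ (size mu + i).+1); last first.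
    by rewrite size_incr_nth; case: ltnP; lia.
  by apply: eq_bigr => i' _; rewrite nth_incr_nth.
rewrite big_split /= -sumn_nth ?(leqW (leq_addr _ _)) //.
have i_lt : i < (size mu + i).+1 by lia.
rewrite (bigD1 (Ordinal i_lt)) //= eqxx big1 // => i' ne_i'.
by move: ne_i'; rewrite -val_eqE eq_sym /= => /negPf ->.
Qed.

(** * Uniform treatment of the two colors *)

(* Transposing the plane exchanges the two colors: with [(p, q) = orient b c],
   an entry [v] of color [b] in cell [c] represents the variable of color [b]
   and index [p + v], and once displaced it is inserted in line [q.+1]. *)
Definition orient b c : cell := if b is Black then c else (c.2, c.1).

Definition var b (k : nat) : variable := if b is Black then X k else Y k.

Lemma orientK b : involutive (orient b).
Proof. by case: b => [[]|[]]. Qed.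

Lemma var_inj b b' (k k' : nat) : var b k = var b' k' -> b = b' /\ k = k'.
Proof. by case: b b' => -[] // [->]. Qed.

Lemma varP (z : variable) : exists b k, z = var b k.
Proof. by case: z => k; [exists Black, k | exists Red, k]. Qed.

Lemma representsE c (v : nat) b : represents c (v, b) = var b ((orient b c).1 + v).
Proof. by case: b. Qed.

Lemma represents_inj c : injective (represents c).
Proof.
move=> [v b] [v' b']; rewrite !representsE => /var_inj[<- /addnI ->] //.
Qed.

Lemma indeterminates_var b (k : nat) : indeterminates (var b k) = (0 < k) :> Prop.
Proof. by case: b. Qed.

(** The cells open to insertion, in a form symmetric under transposition. *)
Definition slot mu c : bool := in_diagram mu c || outer_corner mu c.

Lemma in_diagram_gt0 mu b c :
  in_diagram mu c -> 0 < (orient b c).1 /\ 0 < (orient b c).2.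
Proof. by rewrite /in_diagram; case: b => /=; lia. Qed.

Lemma in_diagram_orient_gt0 mu b (p q : nat) :
  in_diagram mu (orient b (p, q)) -> 0 < p /\ 0 < q.
Proof. by move/(in_diagram_gt0 b); rewrite orientK. Qed.

Lemma in_diagram_orient_sub mu b (p q p' q' : nat) : is_part mu ->
  in_diagram mu (orient b (p', q')) -> 0 < p <= p' -> 0 < q <= q' ->
  in_diagram mu (orient b (p, q)).
Proof.
by case: b => /= mu_part dgm' le_p le_q;
  apply: (in_diagram_sub mu_part dgm').
Qed.

Lemma outer_corner_orient mu b (p q : nat) :
  outer_corner mu (orient b (p, q)) =
  [&& 0 < p, 0 < q, ~~ in_diagram mu (orient b (p, q)),
      (p == 1) || in_diagram mu (orient b (p.-1, q)) &
      (q == 1) || in_diagram mu (orient b (p, q.-1))].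
Proof.
rewrite /outer_corner; case: b => /=; first by [].
by rewrite andbCA [in RHS](andbC (_ || _) (_ || _)).
Qed.

Lemma slot_gt0 mu b (p q : nat) : slot mu (orient b (p, q)) -> 0 < p /\ 0 < q.
Proof.
by case/orP=> [/in_diagram_orient_gt0 // | ]; rewrite outer_corner_orient; lia.
Qed.

Lemma slot_prev mu b (p q p' : nat) : is_part mu ->
  slot mu (orient b (p, q)) -> 0 < p' < p -> in_diagram mu (orient b (p', q)).
Proof.
move=> mu_part slot_pq lt_p'; have [p_gt0 q_gt0] := slot_gt0 slot_pq.
case/orP: slot_pq => [dgm | ].
  by apply: in_diagram_orient_sub dgm _ _ => //; lia.
rewrite outer_corner_orient => /and5P[_ _ _ /orP[/eqP p1 | dgm] _]; first by lia.
by apply: in_diagram_orient_sub dgm _ _ => //; lia.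
Qed.

Lemma slot_sub mu b (p q p' q' : nat) : is_part mu ->
  slot mu (orient b (p, q)) -> in_diagram mu (orient b (p', q')) ->
  p <= p' -> q <= q' -> in_diagram mu (orient b (p, q)).
Proof.
move=> mu_part /slot_gt0[p_gt0 q_gt0] dgm' le_p le_q.
by apply: in_diagram_orient_sub dgm' _ _ => //; lia.
Qed.

(** * Tableaux *)

(** Rows and columns are merged into the componentwise order on cells, which is invariant under
    transposition. *)
Definition monotone S : Prop := forall c1 c2 e1 e2,
  S.[? c1] = Some e1 -> S.[? c2] = Some e2 -> c1.1 <= c2.1 -> c1.2 <= c2.2 ->
  e1.1 <= e2.1.

(** The shape is any predicate, so that a diagram with one added corner is covered directly. *)
Definition tableau (P : pred cell) S : Prop :=
  (forall c, (c \in domf S) = P c) /\ monotone S.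

Lemma tableau_some (P : pred cell) S c : tableau P S -> P c ->
  exists e, S.[? c] = Some e.
Proof. by case=> domS _; rewrite -domS; case: fndP => // cS _; exists S.[cS]. Qed.

Lemma tableau_dom (P : pred cell) S c e : tableau P S -> S.[? c] = Some e -> P c.
Proof. by case=> domS _; rewrite -domS; case: fndP. Qed.

Lemma tableau_none (P : pred cell) S c : tableau P S -> ~~ P c -> S.[? c] = None.
Proof. by case=> domS _; rewrite -domS; case: fndP. Qed.

Lemma tableau_mono (P : pred cell) S b (p q p' q' : nat) e e' : tableau P S ->
  S.[? orient b (p, q)] = Some e -> S.[? orient b (p', q')] = Some e' ->
  p <= p' -> q <= q' -> e.1 <= e'.1.
Proof.
by case=> _ monoS Se Se' le_p le_q; apply: monoS Se Se' _ _; case: b.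
Qed.

Lemma eq_tableau (P P' : pred cell) S : P =1 P' -> tableau P S -> tableau P' S.
Proof. by move=> eqP' [domS monoS]; split=> // c; rewrite domS. Qed.

(** Entries at [(i1, j1)] and [(i2, j2)] are compared through [(i1, j2)], which lies in the
    diagram. *)
Lemma bicoloredE mu S : is_part mu -> bicolored mu S <-> tableau (in_diagram mu) S.
Proof.
move=> mu_part; split=> [[domS rowS colS] | [domS monoS]]; last first.
  by split=> // l => [j1 j2 | i1 i2] e1 e2 Se1 Se2 le_l; apply: monoS Se1 Se2 _ _.
split=> // -[i1 j1] [i2 j2] e1 e2 Se1 Se2 /= le_i le_j.
have dgm c e : S.[? c] = Some e -> in_diagram mu c by rewrite -domS; case: fndP.
have dgm1 := dgm _ _ Se1; have dgm2 := dgm _ _ Se2.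
have : (i1, j2) \in domf S.
  rewrite domS; apply: (in_diagram_sub mu_part dgm2).
    by move: dgm1; rewrite /in_diagram /=; lia.
  by move: dgm2; rewrite /in_diagram /=; lia.
move=> c_dom; have Se := in_fnd c_dom.
exact: leq_trans (rowS _ _ _ _ _ Se1 Se le_j) (colS _ _ _ _ _ Se Se2 le_i).
Qed.

(** The cell may or may not satisfy [P]: this serves both for replacing an entry and for adding
    one. *)
Lemma tableau_set (P : pred cell) S b (p q : nat) e : tableau P S ->
  (forall p' q' e', S.[? orient b (p', q')] = Some e' -> (p', q') <> (p, q) ->
     p' <= p -> q' <= q -> e'.1 <= e.1) ->
  (forall p' q' e', S.[? orient b (p', q')] = Some e' -> (p', q') <> (p, q) ->
     p <= p' -> q <= q' -> e.1 <= e'.1) ->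
  tableau (fun c => P c || (c == orient b (p, q))) S.[orient b (p, q) <- e].
Proof.
move=> [domS monoS] below above; split=> [c|c1 c2 e1 e2].
  by rewrite mem_setf inE domS orbC.
have ne_pq c : (c == orient b (p, q)) = false ->
    ((orient b c).1, (orient b c).2) <> (p, q).
  by move=> /eqP + eq_c; rewrite -eq_c -surjective_pairing orientK.
rewrite !fnd_set; case: eqP => [-> [<-] | /eqP/negPf ne1 Se1].
  case: eqP => [_ [<-] // | /eqP/negPf ne2 Se2 le1 le2].
  apply: (above (orient b c2).1 (orient b c2).2) (ne_pq _ ne2) _ _;
  rewrite -?surjective_pairing ?orientK //;
  by case: (b) le1 le2.
case: eqP => [-> [<-] le1 le2 | _ Se2]; last exact: monoS Se1 Se2.
apply: (below (orient b c1).1 (orient b c1).2) (ne_pq _ ne1) _ _;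
rewrite -?surjective_pairing ?orientK //;
by case: (b) le1 le2.
Qed.

(** * A single insertion step *)

Definition line_incr b S (q : nat) : Prop :=
  if b is Black then col_incr S q else row_incr S q.

Lemma line_incrE b S (q : nat) : line_incr b S q <->
  forall p1 p2 e1 e2, S.[? orient b (p1, q)] = Some e1 ->
    S.[? orient b (p2, q)] = Some e2 -> p1 <= p2 -> e1.1 <= e2.1.
Proof. by case: b. Qed.

Definition fits mu b S (k q p : nat) : Prop :=
  [/\ slot mu (orient b (p, q)), p <= k &
      line_incr b S.[orient b (p, q) <- (k - p, b)] q].

Lemma black_fitsE mu S (k j i : nat) : is_part mu -> 0 < j ->
  black_fits mu S k j i <-> fits mu Black S k j i.
Proof.
move=> mu_part j_gt0; rewrite /black_fits /fits /=.
suff slotE : slot mu (i, j) <-> (1 <= i <= conj_part mu j \/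
    i = (conj_part mu j).+1 /\ (j = 1 \/ conj_part mu j < conj_part mu j.-1)).
  by split=> -[/slotE ? ? ?].
(* Conditions on column lengths are turned into conditions on row lengths, in which the diagram is
   defined. *)
have E := fun i j => @leq_conj_part mu i j mu_part.
have := E i j; have := E i.-1 j; have := E i j.-1.
rewrite /slot /outer_corner /in_diagram /=; lia.
Qed.

Lemma red_fitsE mu S (k i j : nat) : 0 < i ->
  red_fits mu S k i j <-> fits mu Red S k i j.
Proof.
move=> i_gt0; rewrite /red_fits /fits /=.
suff slotE : slot mu (i, j) <-> (1 <= j <= part mu i \/
    j = (part mu i).+1 /\ (i = 1 \/ part mu i < part mu i.-1)).
  by split=> -[/slotE ? ? ?].
rewrite /slot /outer_corner /in_diagram /=; lia.
Qed.

Lemma placesE mu c0 b (k : nat) S c S' : is_part mu ->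
  places mu (State c0 (var b k) S) c S' <->
  exists p, [/\ is_largest (fits mu b S k (orient b c0).2.+1) p,
    c = orient b (p, (orient b c0).2.+1) & S' = S.[c <- (k - p, b)]].
Proof.
move=> mu_part; case: c0 => i0 j0.
have largest_eq (P Q : nat -> Prop) m : (forall n, P n <-> Q n) ->
    is_largest P m <-> is_largest Q m.
  by move=> PQ; rewrite /is_largest PQ; split=> -[? max_m]; split=> // n /PQ /max_m.
case: b => /=; split.
- move E : (State _ _ _) => s pl; case: pl E => // i1 j1 k1 S1 i Hi [? ? ? ?]; subst.
  by exists i; split=> //; apply/largest_eq/Hi => n; rewrite black_fitsE.
- move=> [i [Hi -> ->]]; apply: places_X.
  by apply/largest_eq/Hi => n; rewrite black_fitsE.
- move E : (State _ _ _) => s pl; case: pl E => // i1 j1 k1 S1 i Hi [? ? ? ?]; subst.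
  by exists i; split=> //; apply/largest_eq/Hi => n; rewrite red_fitsE.
- move=> [i [Hi -> ->]]; apply: places_Y.
  by apply/largest_eq/Hi => n; rewrite red_fitsE.
Qed.

(* Since [v + p] increases strictly along a line, the process writes its entry
   at the first position [p] of the line where [v + p >= k]. *)
Definition lands mu b S (k q p : nat) : Prop :=
  [/\ slot mu (orient b (p, q)), 0 < p <= k,
      forall p' e, p' < p -> S.[? orient b (p', q)] = Some e -> e.1 + p' < k &
      forall e, S.[? orient b (p, q)] = Some e -> k <= e.1 + p].

(** Entries before [p] are at most [k - p] and the one at [p] is at least [k - p], so the line stays
    increasing. At a later [p'] the value [k - p'] would be smaller than the entry at [p]. *)
Lemma lands_largest mu b S (k q p : nat) : is_part mu ->
  tableau (in_diagram mu) S -> lands mu b S k q p ->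
  is_largest (fits mu b S k q) p.
Proof.
move=> mu_part tabS [slot_p /andP[p_gt0 le_pk] before after]; split.
  split=> //; apply/line_incrE => p1 p2 e1 e2.
  have orient_eq p' : (orient b (p', q) == orient b (p, q)) = (p' == p).
    by rewrite (inj_eq (inv_inj (orientK b))) xpair_eqE eqxx andbT.
  rewrite !fnd_set !orient_eq.
  case: eqVneq => [-> [<-] | ne1 Se1]; case: eqVneq => [-> [<-] // | ne2 Se2] le12.
  - have Dp2 := tableau_dom tabS Se2.
    have [e Se] := tableau_some tabS (slot_sub mu_part slot_p Dp2 le12 (leqnn q)).
    have := after _ Se; have := tableau_mono tabS Se Se2 le12 (leqnn q).
    by move=> /=; lia.
  - have [p1_gt0 _] := in_diagram_orient_gt0 (tableau_dom tabS Se1).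
    have [|e Se] := tableau_some tabS (@slot_prev mu b p q p.-1 mu_part slot_p _).
      by lia.
    have /= := before _ _ _ Se; have := tableau_mono tabS Se1 Se _ (leqnn q); lia.
  - exact: tableau_mono tabS Se1 Se2 le12 _.
move=> p' [slot_p' le_p'k /line_incrE incr]; rewrite leqNgt; apply/negP=> lt_p.
have [|e Se] := tableau_some tabS (@slot_prev mu b p' q p mu_part slot_p' _).
  by lia.
have := after _ Se; have /= := incr p p' e (k - p', b).
rewrite !fnd_set eqxx (inj_eq (inv_inj (orientK b))) xpair_eqE.
rewrite ltn_eqF //= => /(_ Se erefl (ltnW lt_p)); lia.
Qed.

Lemma places_lands mu c0 b (k p : nat) S c S' : is_part mu ->
  tableau (in_diagram mu) S -> lands mu b S k (orient b c0).2.+1 p ->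
  places mu (State c0 (var b k) S) c S' <->
  c = orient b (p, (orient b c0).2.+1) /\ S' = S.[c <- (k - p, b)].
Proof.
move=> mu_part tabS lands_p; rewrite placesE //.
have [fits_p max_p] := lands_largest mu_part tabS lands_p.
split=> [[p' [[fits_p' max_p'] -> ->]] | [-> ->]]; last by exists p.
by have -> : p' = p by apply/eqP; rewrite eqn_leq max_p ?max_p'.
Qed.

(* The pending variable [var b k] was represented by the entry that the current
   one has replaced in cell [c]; putting it back gives a tableau again. *)
Definition displaced mu b (k : nat) S c : Prop :=
  [/\ in_diagram mu c, (orient b c).1 <= k,
      exists2 e, S.[? c] = Some e & e.1 <= k - (orient b c).1 &
      tableau (in_diagram mu) S.[c <- (k - (orient b c).1, b)]].

(** The loop invariant. Away from [(0, 0)] it records that the pending variable fits back into the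
    current cell, which makes steps reversible. *)
Definition valid mu s : Prop :=
  tableau (in_diagram mu) (current s) /\
  exists b k, [/\ pending s = var b k, 0 < k &
    pos s = (0, 0) \/ displaced mu b k (current s) (pos s)].

Lemma orient00 b : orient b (0, 0) = (0, 0).
Proof. by case: b. Qed.

(** The landing position is the least [p > 0] on the next line whose cell is empty or holds a value
    [v] with [v + p >= k]; it exists because [k] itself qualifies. *)
Lemma valid_lands mu c0 b (k : nat) S : is_part mu ->
  valid mu (State c0 (var b k) S) ->
  exists p, [/\ lands mu b S k (orient b c0).2.+1 p,
    c0 <> (0, 0) -> p <= (orient b c0).1 &
    let c := orient b (p, (orient b c0).2.+1) in
    tableau (fun c' => in_diagram mu c' || (c' == c)) S.[c <- (k - p, b)]].
Proof.
move=> mu_part [/= tabS [_ [_ [/var_inj[<- <-] k_gt0 pos_c0]]]].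
set p0 := (orient b c0).1; set q := (orient b c0).2.+1.
have c0E : c0 = orient b (p0, q.-1) by rewrite -surjective_pairing orientK.
pose stop p := (0 < p) &&
  (if S.[? orient b (p, q)] is Some e then k <= e.1 + p else true).
have stop_k : stop k.
  by rewrite /stop k_gt0 /=; case: fnd => // e; apply: leq_addl.
case: (ex_minnP (ex_intro stop k stop_k)) => p /andP[p_gt0 stop_p] min_p.
have le_pk := min_p k stop_k.
have before p' : 0 < p' < p ->
    exists2 e, S.[? orient b (p', q)] = Some e & e.1 + p' < k.
  move=> lt_p'; have := min_p p'; rewrite /stop.
  by case: fnd => [e|] min_p'; [exists e => // | ]; lia.
have before' p' e : p' < p -> S.[? orient b (p', q)] = Some e -> e.1 + p' < k.
  move=> lt_p' Se; have [p'_gt0 _] := in_diagram_orient_gt0 (tableau_dom tabS Se).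
  by have [|e'] := before p'; [lia | rewrite Se => -[<-]].
have le_p : c0 <> (0, 0) -> p <= p0.
  case: pos_c0 => // -[Dc0 le_p0 _ tabS0] _.
  rewrite c0E in Dc0; have [p0_gt0 _] := in_diagram_orient_gt0 Dc0.
  apply: min_p; rewrite /stop p0_gt0 /=; case Se : fnd => [e|] //.
  have ne : (orient b (p0, q) == c0) = false.
    by rewrite c0E (inj_eq (inv_inj (orientK b))) xpair_eqE eqxx gtn_eqF ?prednK.
  (* With the variable put back at [c0], monotonicity across to line [q] gives [k - p0 <= e.1], so
     the search stops at [p0] at the latest. *)
  have /= := @tableau_mono _ _ b p0 q.-1 p0 q (k - p0, b) e tabS0.
  by rewrite !fnd_set -c0E eqxx ne Se => /(_ erefl erefl (leqnn _) (leq_pred _)); lia.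
have slot_p : slot mu (orient b (p, q)).
  (* Outside the diagram the cell is an outer corner: its predecessor on the line is filled by
     minimality of [p], and its neighbour on the previous line lies in the diagram because
     [p <= p0]. *)
  rewrite /slot; case Dc : in_diagram => //=; rewrite outer_corner_orient p_gt0 Dc /=.
  apply/andP; split.
    have [//|ne_p1] := eqVneq p 1; have [|e Se _] := before p.-1; first by lia.
    by rewrite (tableau_dom tabS Se).
  case: pos_c0 => [c0_0 | [Dc0 _ _ _]]; first by rewrite /q c0_0 orient00.
  have [//|ne_q /=] := eqVneq q 1.
  rewrite c0E in Dc0; apply: in_diagram_orient_sub Dc0 _ _ => //; last by lia.
  by rewrite p_gt0 le_p // => c0_0; rewrite /q c0_0 orient00 in ne_q.
have lands_p : lands mu b S k q p.
  by split=> //; [rewrite p_gt0 | move=> e Se; rewrite Se in stop_p].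
(* Smaller cells with [p' < p] are controlled by the entry at [p - 1] on line [q]. Those with
   [p' = p] lie on earlier lines and are controlled by the entry at [c0], which is at most
   [k - p0 <= k - p]. *)
exists p; split=> //=; apply: tableau_set => // p' q' e Se ne le_p' le_q' /=.
  have [p'_gt0 q'_gt0] := in_diagram_orient_gt0 (tableau_dom tabS Se).
  have [lt_p' | ge_p'] := ltnP p' p.
    have [|e1 Se1 lt_k] := before p.-1; first by lia.
    by have := tableau_mono tabS Se Se1 _ le_q'; lia.
  have {ge_p'}p'E : p' = p by lia.
  have lt_q' : q' < q.
    by rewrite ltn_neqAle le_q' andbT; apply/eqP => q'E; rewrite p'E q'E in ne.
  have nc0 : c0 <> (0, 0) by move=> c0_0; move: lt_q'; rewrite /q c0_0 orient00 /=; lia.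
  case: pos_c0 => // -[_ _ [e0 Se0 le_e0] _]; rewrite c0E in Se0.
  have := tableau_mono tabS Se Se0; have := le_p nc0; rewrite /p0 in le_e0 *; lia.
have Dp := slot_sub mu_part slot_p (tableau_dom tabS Se) le_p' le_q'.
have [e1 Se1] := tableau_some tabS Dp; rewrite Se1 in stop_p.
by have := tableau_mono tabS Se1 Se le_p' le_q'; lia.
Qed.

(** * Reversing a single step *)

Lemma slot_prev_line mu b (p q q' : nat) : is_part mu ->
  slot mu (orient b (p, q)) -> 0 < q' < q -> in_diagram mu (orient b (p, q')).
Proof.
by case: b; [apply: (@slot_prev mu Red q p q') | apply: (@slot_prev mu Black q p q')].
Qed.

(** For [q = 1] the source is the initial position. Otherwise it is the greatest [p0] on line
    [q - 1] whose entry plus [p0] is at most [k = p + v]; there the variable fits back. *)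
Lemma valid_unplace mu b S (p q v : nat) : is_part mu ->
  let c := orient b (p, q) in
  tableau (in_diagram mu) S -> slot mu c ->
  tableau (fun c' => in_diagram mu c' || (c' == c)) S.[c <- (v, b)] ->
  (forall e, S.[? c] = Some e -> v <= e.1) ->
  exists2 c0, valid mu (State c0 (var b (p + v)) S) &
    places mu (State c0 (var b (p + v)) S) c S.[c <- (v, b)].
Proof.
move=> mu_part c tabS slot_c tabS' le_v; have [p_gt0 q_gt0] := slot_gt0 slot_c.
set k := p + v.
have S'c : S.[c <- (v, b)].[? orient b (p, q)] = Some (v, b) by rewrite fnd_set eqxx.
have S'E p' q' e : (p', q') <> (p, q) -> S.[? orient b (p', q')] = Some e ->
    S.[c <- (v, b)].[? orient b (p', q')] = Some e.
  move=> /eqP ne Se; rewrite fnd_set -Se.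
  by rewrite (inj_eq (inv_inj (orientK b))) (negPf ne).
have lands_p : lands mu b S k q p.
  split=> //; first by rewrite p_gt0 leq_addr.
    move=> p' e lt_p' Se.
    have ne : (p', q) <> (p, q) by case=> p'E; rewrite p'E ltnn in lt_p'.
    by have /= := tableau_mono tabS' (S'E _ _ _ ne Se) S'c (ltnW lt_p') (leqnn q); lia.
  by move=> e /le_v; lia.
have kp : k - p = v by rewrite addKn.
have [q1 | ne_q1] := eqVneq q 1.
  exists (0, 0).
    by split=> //; exists b, k; split=> //; [lia | left].
  apply/(@places_lands _ _ _ _ p); rewrite ?orient00 ?kp -?q1 //.
have qE : q.-1.+1 = q by rewrite prednK.
pose small p' := if S.[? orient b (p', q.-1)] is Some e then e.1 + p' <= k else false.
(* Position [p] qualifies because its entry on line [q - 1] is at most the value [v] next to it;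
   hence also [p <= p0]. *)
have small_p : small p.
  have Dp : in_diagram mu (orient b (p, q.-1)).
    by apply: slot_prev_line slot_c _ => //; lia.
  have [e Se] := tableau_some tabS Dp; rewrite /small Se.
  have ne : (p, q.-1) <> (p, q) by case; lia.
  by have /= := tableau_mono tabS' (S'E _ _ _ ne Se) S'c (leqnn p) (leq_pred q); lia.
have small_le p' : small p' -> p' <= k.
  by rewrite /small; case: fnd => // e; apply: leq_trans (leq_addl _ _).
case: (ex_maxnP (ex_intro small p small_p) small_le) => p0 small_p0 max_p0.
have le_p0 := max_p0 p small_p; have le_p0k := small_le p0 small_p0.
move: small_p0; rewrite /small; case Se0 : fnd => [e0|] // le_e0.
have Dc0 := tableau_dom tabS Se0.
exists (orient b (p0, q.-1)); last first.
  by apply/(@places_lands _ _ _ _ p); rewrite ?orientK /= ?qE ?kp.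
split=> //; exists b, k; split=> //; [lia | right].
rewrite /displaced orientK /=; split=> //; first by exists e0 => //; lia.
apply: (@eq_tableau (fun c' => in_diagram mu c' || (c' == orient b (p0, q.-1)))).
  by move=> c' /=; case: eqP => [-> | _]; rewrite ?orbF // Dc0.
apply: tableau_set => // p' q' e Se ne le_p' le_q' /=.
  by have := tableau_mono tabS Se Se0 le_p' le_q'; lia.
(* Beyond [p0], maximality makes the entry at [p0 + 1] at least [k - p0]. At [p0] itself the cell
   lies on line [q] or later, and comparison with the value [v = k - p >= k - p0] at [(p, q)]
   suffices. *)
have [lt_p' | ge_p'] := ltnP p0 p'.
  have Dp1 : in_diagram mu (orient b (p0.+1, q.-1)).
    by apply: in_diagram_orient_sub (tableau_dom tabS Se) _ _ => //; lia.
  have [e1 Se1] := tableau_some tabS Dp1.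
  have := tableau_mono tabS Se1 Se lt_p' le_q'.
  by have := max_p0 p0.+1; rewrite /small Se1; lia.
have p'E : p' = p0 by lia.
have lt_q' : q <= q'.
  rewrite -qE ltn_neqAle le_q' andbT; apply/eqP => q'E.
  by rewrite p'E q'E in ne.
have [pq_eq | /eqP ne'] := eqVneq (p', q') (p, q).
  by have := le_v e; rewrite /c -pq_eq => /(_ Se); lia.
by have /= := tableau_mono tabS' S'c (S'E _ _ _ ne' Se) _ lt_q'; lia.
Qed.

(** For [p1 < p2], the variable put back at [p1] has value [k - p1 > k - p2], yet the entry at [p2]
    is at most [k - p2]. *)
Lemma displaced_inj mu b (k p p' q : nat) S :
  displaced mu b k S (orient b (p, q)) -> displaced mu b k S (orient b (p', q)) ->
  p = p'.
Proof.
suff le p1 p2 : displaced mu b k S (orient b (p1, q)) ->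
    displaced mu b k S (orient b (p2, q)) -> p2 <= p1.
  by move=> dp dp'; apply/eqP; rewrite eqn_leq !le.
rewrite /displaced !orientK /= => -[_ _ _ tabS1] [_ le_p2 [e2 Se2 le_e2] _].
rewrite leqNgt; apply/negP => lt_p.
have /= := @tableau_mono _ _ b p1 q p2 q (k - p1, b) e2 tabS1.
rewrite !fnd_set eqxx (inj_eq (inv_inj (orientK b))) xpair_eqE gtn_eqF //=.
by move=> /(_ erefl Se2 (ltnW lt_p) (leqnn q)); lia.
Qed.

Lemma valid_places_inj mu c0 c0' (w w' : variable) S c S' : is_part mu ->
  valid mu (State c0 w S) -> valid mu (State c0' w' S) ->
  places mu (State c0 w S) c S' -> places mu (State c0' w' S) c S' ->
  State c0 w S = State c0' w' S.
Proof.
move=> mu_part; case: (varP w) (varP w') => b [k ->] [b' [k' ->]] val val'.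
have [p [lands_p _ _]] := valid_lands mu_part val.
have [p' [lands_p' _ _]] := valid_lands mu_part val'.
case: val val' => /= tabS [_ [_ [/var_inj[<- <-] _ pos_c0]]].
case=> /= _ [_ [_ [/var_inj[<- <-] _ pos_c0']]].
case/(places_lands _ _ mu_part tabS lands_p) => cE S'E.
case/(places_lands _ _ mu_part tabS lands_p') => cE' S'E'.
have : S'.[? c] = Some (k' - p', b') by rewrite S'E' fnd_set eqxx.
rewrite S'E fnd_set eqxx => -[vE bE].
case: _ / bE in lands_p' pos_c0' cE' {S'E'} *.
move: cE'; rewrite cE => /(inv_inj (orientK b)) [p_eq q_eq].
have kE : k = k' by case: lands_p lands_p' => _ ? _ _ [_ ? _ _]; lia.
rewrite -kE in pos_c0' *; congr State.
have Dgt0 c1 : displaced mu b k S c1 -> 0 < (orient b c1).2.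
  by case=> /(in_diagram_gt0 b)[].
case: pos_c0 pos_c0' => [c00 | disp] [c00' | disp']; first by rewrite c00 c00'.
- by have := Dgt0 _ disp'; rewrite -q_eq c00 orient00.
- by have := Dgt0 _ disp; rewrite q_eq c00' orient00.
apply: (inv_inj (orientK b)).
rewrite [orient b c0]surjective_pairing [orient b c0']surjective_pairing q_eq.
congr (_, _); apply: (@displaced_inj mu b k _ _ (orient b c0').2 S).
  by rewrite -q_eq -surjective_pairing orientK.
by rewrite -surjective_pairing orientK.
Qed.

Lemma places_fun mu s c1 c2 S1 S2 : is_part mu -> valid mu s ->
  places mu s c1 S1 -> places mu s c2 S2 -> c1 = c2 /\ S1 = S2.
Proof.
case: s => c0 w S mu_part; case: (varP w) => b [k ->] val.
have [p [lands_p _ _]] := valid_lands mu_part val.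
case/(places_lands _ _ mu_part val.1 lands_p) => -> ->.
by case/(places_lands _ _ mu_part val.1 lands_p) => -> ->.
Qed.

Lemma places_spec mu s : is_part mu -> valid mu s ->
  exists b k p c, [/\ pending s = var b k, p <= k, (orient b c).1 = p,
    (orient b c).2 = (orient b (pos s)).2.+1 &
    [/\ slot mu c, pos s <> (0, 0) -> p <= (orient b (pos s)).1,
      forall e, (current s).[? c] = Some e -> k - p <= e.1,
      places mu s c (current s).[c <- (k - p, b)] &
      tableau (fun c' => in_diagram mu c' || (c' == c))
        (current s).[c <- (k - p, b)]]].
Proof.
case: s => c0 w S mu_part; case: (varP w) => b [k ->] val.
have [p [lands_p le_p tab_p]] := valid_lands mu_part val.
exists b, k, p, (orient b (p, (orient b c0).2.+1)).
have [slot_p /andP[p_gt0 le_pk] _ after] := lands_p.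
split; rewrite ?orientK //; split=> //; first by move=> e /after; lia.
exact/(places_lands _ _ mu_part val.1 lands_p).
Qed.

(** * The transition system *)

Lemma continues_spec mu s s' : is_part mu -> valid mu s -> continues mu s s' ->
  exists b k c e,
    [/\ pending s = var b k,
        s' = State c (represents c e) (current s).[c <- (k - (orient b c).1, b)],
        (orient b c).1 <= k, (orient b c).2 = (orient b (pos s)).2.+1 &
    [/\ in_diagram mu c, (current s).[? c] = Some e, k - (orient b c).1 <= e.1,
        pos s <> (0, 0) -> (orient b c).1 <= (orient b (pos s)).1 &
        tableau (in_diagram mu) (current s).[c <- (k - (orient b c).1, b)]]].
Proof.
move=> mu_part val [c S' e pl Dc Se].
have [b [k [p [c' [pendE le_pk pE qE [_ le_p le_e pl' tab']]]]]] :=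
  places_spec mu_part val.
rewrite -{}pE in le_pk le_p le_e pl' tab'.
have [c'E S'E] := places_fun mu_part val pl' pl; rewrite -{}S'E.
rewrite {}c'E in le_pk qE le_p le_e tab' *; exists b, k, c, e.
split=> //; split=> //; first exact: le_e.
by apply: eq_tableau tab' => c1 /=; case: eqP => [-> | _]; rewrite ?orbF // Dc.
Qed.

Lemma setf_fnd S c e : S.[? c] = Some e -> S.[c <- e] = S.
Proof. by move=> Se; apply/fmapP=> c'; rewrite fnd_set; case: eqP => // ->. Qed.

Lemma setf_setf S c e e' : S.[c <- e].[c <- e'] = S.[c <- e'].
Proof. by apply/fmapP=> c'; rewrite !fnd_set; case: eqP. Qed.

(** Putting the replaced entry back restores the previous filling, a tableau; this gives [displaced]
    for the new state. *)
Lemma continues_valid mu s s' : is_part mu -> valid mu s -> continues mu s s' ->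
  valid mu s' /\ pos s' <> (0, 0).
Proof.
move=> mu_part val cont.
have [b [k [c [[v b'] [_ -> le_pk _ [Dc Se le_e _ tab]]]]]] :=
  continues_spec mu_part val cont.
split=> /=; last by move=> c0; rewrite c0 in Dc.
split=> //=; exists b', ((orient b' c).1 + v); rewrite representsE; split=> //.
  by have [] := in_diagram_gt0 b' Dc; lia.
right; rewrite /displaced addKn setf_setf (setf_fnd Se) leq_addr.
by split=> //; [exists (k - (orient b c).1, b); rewrite // fnd_set eqxx | case: val].
Qed.

Lemma valid_progress mu s : is_part mu -> valid mu s ->
  (exists s', continues mu s s') \/ (exists S', stops mu s S').
Proof.
move=> mu_part val.
have [b [k [p [c [_ _ _ _ [/orP[Dc | out_c] _ _ pl _]]]]]] := places_spec mu_part val.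
  have [e Se] := tableau_some val.1 Dc.
  by left; eexists; apply: Continues pl Dc Se.
by right; eexists; apply: Stops pl out_c.
Qed.

Lemma continues_fun mu s s1 s2 : is_part mu -> valid mu s ->
  continues mu s s1 -> continues mu s s2 -> s1 = s2.
Proof.
move=> mu_part val [c1 S1 e1 pl1 _ Se1] [c2 S2 e2 pl2 _].
have [<- <-] := places_fun mu_part val pl1 pl2.
by rewrite Se1 => -[->].
Qed.

Lemma stops_fun mu s S1 S2 : is_part mu -> valid mu s ->
  stops mu s S1 -> stops mu s S2 -> S1 = S2.
Proof.
move=> mu_part val [c1 S1' pl1 _] [c2 S2' pl2 _].
by have [_ ->] := places_fun mu_part val pl1 pl2.
Qed.

Lemma continues_not_stops mu s s' S' : is_part mu -> valid mu s ->
  continues mu s s' -> ~ stops mu s S'.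
Proof.
move=> mu_part val [c1 S1 e1 pl1 Dc1 _] [c2 S2 pl2 /and5P[_ _ + _ _]].
by have [<- _] := places_fun mu_part val pl1 pl2; rewrite Dc1.
Qed.

(** * Reversing the transitions *)

Lemma places_set mu s c S' : places mu s c S' ->
  exists e, S' = (current s).[c <- e].
Proof. by case=> *; eexists. Qed.

(** The new state shows the cell and, as [represents c] is injective, the replaced entry; restoring
    it recovers the previous filling. *)
Lemma continues_inj mu s1 s2 s' : is_part mu -> valid mu s1 -> valid mu s2 ->
  continues mu s1 s' -> continues mu s2 s' -> s1 = s2.
Proof.
move=> mu_part val1 val2 [c S' e pl1 Dc Se1].
move E : (State _ _ _) => s'' cont2; case: cont2 E => c2 S2 e2 pl2 _ Se2 [cE wE S'E].
rewrite -{}cE -{}S'E in pl2 wE Se2 *; rewrite -{}(represents_inj wE) in Se2.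
have curE : current s1 = current s2.
  have [e1' S'1] := places_set pl1; have [e2' S'2] := places_set pl2.
  by rewrite -(setf_fnd Se1) -(setf_setf _ _ e1') -S'1 S'2 setf_setf setf_fnd.
case: s1 s2 val1 val2 pl1 pl2 curE {Se1 Se2} => c1 w1 S1 [c2' w2 S2'] /=.
move=> val1 val2 pl1 pl2 curE; rewrite -curE in val2 pl2 *.
by apply: valid_places_inj pl1 pl2.
Qed.

(** The written cell is the only one of [S'] outside the diagram, so both steps wrote there and
    started from the same filling. *)
Lemma stops_inj mu s1 s2 S' : is_part mu -> valid mu s1 -> valid mu s2 ->
  stops mu s1 S' -> stops mu s2 S' -> s1 = s2.
Proof.
move=> mu_part val1 val2 [c S1 pl1 out1]; move E : S1 => S2 stop2.
case: stop2 E => c2 {}S2 pl2 out2 S12; rewrite -{}S12 {S2} in pl2.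
have [e1 S1E] := places_set pl1; have [e2 S1E'] := places_set pl2.
have [out1' out2'] : ~~ in_diagram mu c /\ ~~ in_diagram mu c2.
  by split; [case/and5P: out1 | case/and5P: out2].
have cE : c2 = c.
  have : c \in domf S1 by rewrite S1E mem_setf inE eqxx.
  by rewrite S1E' mem_setf inE val2.1.1 (negPf out1') orbF => /eqP.
rewrite {}cE in pl2 S1E' out2 {out2'}.
have curE : current s1 = current s2.
  apply/fmapP => c'; have [-> | ne] := eqVneq c' c.
    by rewrite (tableau_none val1.1) ?(tableau_none val2.1).
  have := congr1 (fun S => S.[? c']) (etrans (esym S1E) S1E').
  by rewrite !fnd_set (negPf ne).
case: s1 s2 val1 val2 pl1 pl2 curE {S1E S1E'} => c1 w1 S1' [c2' w2 S2'] /=.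
move=> val1 val2 pl1 pl2 curE; rewrite -curE in val2 pl2 *.
by apply: valid_places_inj pl1 pl2.
Qed.

Lemma stops_tableau mu s S' : is_part mu -> valid mu s -> stops mu s S' ->
  exists2 c, outer_corner mu c &
    tableau (fun c' => in_diagram mu c' || (c' == c)) S'.
Proof.
move=> mu_part val [c S1 pl out_c]; exists c => //.
have [b [k [p [c' [_ _ _ _ [_ _ _ pl' tab']]]]]] := places_spec mu_part val.
by have [cE S1E] := places_fun mu_part val pl' pl; rewrite S1E cE in tab'.
Qed.

(** Returning the pending variable to its cell gives the earlier filling; the entry it pushes out is
    the one the step had written, and [valid_unplace] finds its source. *)
Lemma continues_surj mu s' : is_part mu -> valid mu s' -> pos s' <> (0, 0) ->
  exists2 s, valid mu s & continues mu s s'.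
Proof.
case: s' => c w' S' mu_part [/= tabS' [b' [k' [-> _ [// | disp]]]]] _.
have [Dc le_pk [[v b] S'c le_v] tabS] := disp.
set e := (k' - _, b') in tabS; rewrite -/e.1 in le_v; set S := S'.[c <- e] in tabS.
have S'E : S' = S.[c <- (v, b)] by rewrite setf_setf setf_fnd.
have Sc : S.[? c] = Some e by rewrite fnd_set eqxx.
have [||||c0 val pl] :=
  @valid_unplace mu b S (orient b c).1 (orient b c).2 v mu_part;
  rewrite -?surjective_pairing ?orientK -?S'E //.
- by rewrite /slot Dc.
- by apply: eq_tableau tabS' => c' /=; case: eqP => [-> | _]; rewrite ?orbF // Dc.
- by move=> e1; rewrite Sc => -[<-].
exists (State c0 (var b ((orient b c).1 + v)) S) => //.
have -> : var b' k' = represents c e by rewrite representsE subnKC.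
apply: (@Continues _ _ c S' e) => //.
by move: pl; rewrite -surjective_pairing orientK -S'E.
Qed.

Lemma stops_surj mu c S' : is_part mu -> outer_corner mu c ->
  tableau (fun c' => in_diagram mu c' || (c' == c)) S' ->
  exists2 s, valid mu s & stops mu s S'.
Proof.
move=> mu_part out_c tabS'; have /and5P[_ _ Dc _ _] := out_c.
have [[v b] S'c] : exists e, S'.[? c] = Some e.
  by apply: tableau_some tabS' _; rewrite /= eqxx orbT.
have S'E : S' = S'.[~ c].[c <- (v, b)] by rewrite setf_rem1 setf_fnd.
have tabS : tableau (in_diagram mu) S'.[~ c].
  split=> [c' | c1 c2 e1 e2].
    rewrite mem_remf1 tabS'.1; case: eqP => [-> | _]; rewrite ?orbF //=.
    by rewrite (negPf Dc).
  rewrite !fnd_rem1; case: ifP => // _ Se1; case: ifP => // _ Se2.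
  exact: tabS'.2 Se1 Se2.
have [||||c0 val pl] :=
  @valid_unplace mu b S'.[~ c] (orient b c).1 (orient b c).2 v mu_part;
  rewrite -?surjective_pairing ?orientK -?S'E //.
- by rewrite /slot out_c orbT.
- by move=> e1; rewrite fnd_rem1 eqxx.
exists (State c0 (var b ((orient b c).1 + v)) S'.[~ c]) => //.
by apply: Stops out_c; move: pl; rewrite -surjective_pairing orientK -S'E.
Qed.

(** * Sums and products over the entries of a filling *)

(** Generic, so that the weight and the sums of values share the same update rules. *)
Definition big_filling (R : Type) (idx : R) (op : R -> R -> R)
    (F : cell -> entry -> R) S : R :=
  \big[op/idx]_(c : domf S) F (val c) (S c).

Lemma big_filling_set (R : Type) (idx : R) (op : Monoid.com_law idx)
    (F : cell -> entry -> R) S c e : S.[? c] = None ->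
  big_filling idx op F S.[c <- e] = op (F c e) (big_filling idx op F S).
Proof.
move=> Sc.
(* Lookups with a default [idx], never reached on the domain, avoid index types that change with the
   filling. *)
have bigE T : big_filling idx op F T =
    \big[op/idx]_(c' <- domf T) oapp (F c') idx T.[? c'].
  rewrite big_seq_fsetE; apply: eq_bigr => c' _.
  by rewrite (in_fnd (valP c')) /=; congr (F _ (T _)); apply: val_inj.
have c_notin : c \notin domf S by case: fndP Sc.
rewrite !bigE; under eq_bigr do rewrite fnd_set.
rewrite dom_setf big_fsetU1 //= eqxx; congr (op _ _).
apply: eq_big_seq => c' c'_in; case: eqP => // c'E.
by rewrite -c'E c'_in in c_notin.
Qed.

(** Stated with a factor on each side because a commutative monoid has no division. *)
Lemma big_filling_replace (R : Type) (idx : R) (op : Monoid.com_law idx)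
    (F : cell -> entry -> R) S c e e' : S.[? c] = Some e ->
  op (big_filling idx op F S.[c <- e']) (F c e) =
  op (big_filling idx op F S) (F c e').
Proof.
move=> Se; have Sc : S.[~ c].[? c] = None by rewrite fnd_rem1 eqxx.
rewrite -[in RHS](setf_fnd Se) -!(setf_rem1 S) !big_filling_set //.
by rewrite Monoid.mulmAC [RHS]Monoid.mulmAC; congr (op _ _); rewrite Monoid.mulmC.
Qed.

HB.instance Definition _ := Monoid.isComLaw.Build monomial mono_one mono_mul
  (@monalg.mulcmA _) (@monalg.mulcmC _) (@monalg.mul0cm _).

Lemma weightE S : weight S =
  big_filling mono_one mono_mul (fun c e => mono_var (represents c e)) S.
Proof. by []. Qed.

(** * Termination in both directions *)

Definition var_index (z : variable) : nat := match z with X k => k | Y k => k end.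

Lemma var_indexE b (k : nat) : var_index (var b k) = k.
Proof. by case: b. Qed.

(* The value of the entry that represented the pending variable before it was
   displaced from the current position. *)
Definition pending_value s : nat :=
  match pending s with X k => k - (pos s).1 | Y k => k - (pos s).2 end.

Lemma pending_valueE s b (k : nat) :
  pending s = var b k -> pending_value s = k - (orient b (pos s)).1.
Proof. by rewrite /pending_value; case: b => ->. Qed.

Definition bounded (K : nat) s : Prop :=
  var_index (pending s) <= K /\
  forall c e, (current s).[? c] = Some e -> var_index (represents c e) <= K.

Lemma leq_var_index c e : e.1 <= var_index (represents c e).
Proof. by case: e => v b; rewrite representsE var_indexE leq_addl. Qed.

Lemma bounded_exists s : exists K, bounded K s.
Proof.
pose M := \max_(c : domf (current s)) var_index (represents (val c) (current s c)).
exists (maxn (var_index (pending s)) M); split=> [|c e]; first exact: leq_maxl.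
case: fndP => // c_in [<-]; apply: leq_trans (leq_maxr _ _).
exact: (@leq_bigmax _ (fun c' : domf _ =>
  var_index (represents (val c') (current s c'))) [` c_in]).
Qed.

(** A step exchanges the pending variable with the one represented by the replaced entry, so the
    variables in play stay the same. *)
Lemma continues_bounded mu s s' (K : nat) : is_part mu -> valid mu s ->
  continues mu s s' -> bounded K s <-> bounded K s'.
Proof.
move=> mu_part val cont.
have [b [k [c [e [pendE -> le_pk _ [_ Se _ _ _]]]]]] := continues_spec mu_part val cont.
rewrite /bounded /= pendE var_indexE.
have newE : var_index (represents c (k - (orient b c).1, b)) = k.
  by rewrite representsE var_indexE subnKC.
split=> -[le_w le_S]; split.
- exact: le_S Se.
- move=> c' e'; rewrite fnd_set; case: eqP => [-> [<-] | _]; last exact: le_S.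
  by rewrite newE.
- by have := le_S c (k - (orient b c).1, b); rewrite fnd_set eqxx newE; apply.
- move=> c' e' Se'; have [c'E | ne] := eqVneq c' c.
    by move: Se'; rewrite c'E Se => -[<-].
  by apply: le_S; rewrite fnd_set (negPf ne).
Qed.

(** Mixed-radix code of a triple, ordered lexicographically while [v <= K] and [d <= N]. *)
Definition lex_code (K N a v d : nat) : nat := (a * K.+1 + v) * N.+1 + d.

Lemma lex_code_ltn (K N a v d a' v' d' : nat) :
  v <= K -> v' <= K -> d <= N -> d' <= N ->
  a < a' \/ a = a' /\ (v < v' \/ v = v' /\ d < d') ->
  lex_code K N a v d < lex_code K N a' v' d'.
Proof.
move=> le_v le_v' le_d le_d' lt_adv; rewrite /lex_code.
have code_lt (x y x' y' M : nat) : y <= M -> x < x' -> x * M.+1 + y < x' * M.+1 + y'.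
  move=> le_y lt_x; apply: (@leq_trans (x.+1 * M.+1)).
    by rewrite mulSn addnC ltn_add2r.
  by apply: leq_trans (leq_addr _ _); rewrite leq_mul2r lt_x orbT.
case: lt_adv => [lt_a | [-> [lt_v | [-> lt_d]]]].
- by apply/code_lt/code_lt.
- by apply: code_lt => //; rewrite ltn_add2l.
- by rewrite ltn_add2l.
Qed.

(** If the new value equals the replaced [v], then [v = k - p >= k - p0] because [p <= p0]. Equality
    forces [p = p0], and the line number grows by one. *)
Lemma continues_lex mu s s' : is_part mu -> valid mu s -> pos s <> (0, 0) ->
  continues mu s s' ->
  exists c e e', [/\ current s' = (current s).[c <- e'],
    (current s).[? c] = Some e & e'.1 < e.1 \/ e'.1 = e.1 /\
    (pending_value s < pending_value s' \/ pending_value s = pending_value s' /\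
     (pos s).1 + (pos s).2 < (pos s').1 + (pos s').2)].
Proof.
move=> mu_part val ne0 cont.
have [b [k [c [[v b'] [pendE -> le_pk qE [Dc Se le_e le_p _]]]]]] :=
  continues_spec mu_part val cont.
exists c, (v, b'), (k - (orient b c).1, b); split=> //=.
rewrite (pending_valueE pendE).
have -> : pending_value (State c (represents c (v, b'))
    (current s).[c <- (k - (orient b c).1, b)]) = v.
  by rewrite (@pending_valueE (State _ _ _) _ _ (representsE c v b')) /= addKn.
have posE c' : c'.1 + c'.2 = (orient b c').1 + (orient b c').2.
  by case: (b) => //=; rewrite addnC.
have le_p0k : (orient b (pos s)).1 <= k.
  by case: val => _ [b1 [k1 [+ _ [// | []]]]]; rewrite pendE => /var_inj[<- <-].
by rewrite (posE (pos s)) (posE c) qE; move: (le_p ne0) le_e => /=; lia.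
Qed.

Definition entry_sum S : nat := big_filling 0 addn (fun _ e => e.1) S.
Definition entry_cosum (K : nat) S : nat := big_filling 0 addn (fun _ e => K - e.1) S.

(** For the forward direction; the two components that grow enter through their complements. *)
Definition rank mu (K : nat) s : nat :=
  let N := size mu + sumn mu in
  lex_code K N (entry_sum (current s)) (K - pending_value s)
    (N - ((pos s).1 + (pos s).2)).

(** For the backward direction; here the entries enter through their complements to [K]. *)
Definition corank mu (K : nat) s : nat :=
  lex_code K (size mu + sumn mu) (entry_cosum K (current s)) (pending_value s)
    ((pos s).1 + (pos s).2).

Lemma valid_bound mu s : is_part mu -> valid mu s ->
  (pos s).1 + (pos s).2 <= size mu + sumn mu.
Proof.
move=> mu_part [_ [b [k [_ _ [-> // | [Dc _ _ _]]]]]].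
exact: in_diagram_bound.
Qed.

Lemma pending_value_bound s (K : nat) : bounded K s -> pending_value s <= K.
Proof.
case=> le_w _; apply: leq_trans le_w; rewrite /pending_value.
by case: (pending s) => k; apply: leq_subr.
Qed.

(** The step out of [(0, 0)] is excluded, since there the landing position is not bounded by the
    previous one. *)
Lemma continues_rank mu s s' (K : nat) : is_part mu -> valid mu s ->
  pos s <> (0, 0) -> bounded K s -> continues mu s s' ->
  rank mu K s' < rank mu K s /\ corank mu K s < corank mu K s'.
Proof.
move=> mu_part val ne0 bd cont.
have bd' : bounded K s' by apply/(continues_bounded _ mu_part val cont).
have [val' _] := continues_valid mu_part val cont.
have le_pos := valid_bound mu_part val; have le_pos' := valid_bound mu_part val'.
have le_v := pending_value_bound bd; have le_v' := pending_value_bound bd'.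
have [c [e [e' [curE Se lex]]]] := continues_lex mu_part val ne0 cont.
have le_e : e.1 <= K by apply: leq_trans (leq_var_index c e) (bd.2 _ _ Se).
have := @big_filling_replace _ _ addn (fun _ e => e.1) (current s) c e e' Se.
have := @big_filling_replace _ _ addn (fun _ e => K - e.1) (current s) c e e' Se.
rewrite -curE -!/(entry_cosum _ _) -!/(entry_sum _) /= => coE sumE.
by split; apply: lex_code_ltn; lia.
Qed.

(** * The bijection *)

(** Steps are appended at the end, which suits tracing a run back, whereas [outputs] unfolds from
    the start. *)
Definition reaches mu : state -> state -> Prop := clos_refl_trans_n1 _ (continues mu).

Lemma reaches_valid mu s s' : is_part mu -> valid mu s -> reaches mu s s' ->
  valid mu s'.
Proof.
move=> mu_part val; elim=> // s1 s2 cont _ val1.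
by have [] := continues_valid mu_part val1 cont.
Qed.

Lemma outputsE mu s S' : outputs mu s S' <->
  exists2 s', reaches mu s s' & stops mu s' S'.
Proof.
split=> [| [s' reach]].
  elim=> [s1 S1 stop1 | s1 s2 S1 cont _ [s3 reach3 stop3]].
    by exists s1 => //; apply: rtn1_refl.
  exists s3 => //; apply: clos_rt_rtn1; apply: rt_trans (clos_rtn1_rt _ _ _ _ reach3).
  exact: rt_step.
have {reach} : clos_refl_trans_1n _ (continues mu) s s'.
  exact/clos_rt_rt1n/clos_rtn1_rt.
elim=> [s1 | s1 s2 s3 cont _ IH] stop; first exact: outputs_stop.
exact: outputs_continue cont (IH stop).
Qed.

Lemma valid_terminates mu s : is_part mu -> valid mu s -> terminates mu s.
Proof.
move=> mu_part val; suff later s' : valid mu s' -> pos s' <> (0, 0) -> terminates mu s'.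
  apply: Terminates => [|s' cont]; first exact: valid_progress.
  by have [val' ne0] := continues_valid mu_part val cont; apply: later.
have [K bd] := bounded_exists s'; have [n] := ubnP (rank mu K s').
elim: n s' bd => [|n IH] s' bd lt_n val' ne0; first by rewrite ltn0 in lt_n.
apply: Terminates => [|s2 cont].
  exact: valid_progress.
have [val2 ne2] := continues_valid mu_part val' cont.
have [lt_rank _] := continues_rank mu_part val' ne0 bd cont.
apply: (IH _ _ _ val2 ne2); first exact/(continues_bounded _ mu_part val' cont).
by rewrite ltnS in lt_n; apply: leq_trans lt_rank lt_n.
Qed.

Lemma terminates_outputs mu s : terminates mu s -> exists S', outputs mu s S'.
Proof.
elim=> {}s [[s' cont] | [S' stop]] _ IH; last by exists S'; apply: outputs_stop.
by have [S' out] := IH _ cont; exists S'; apply: outputs_continue cont out.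
Qed.

Lemma outputs_fun mu s S1 S2 : is_part mu -> valid mu s ->
  outputs mu s S1 -> outputs mu s S2 -> S1 = S2.
Proof.
move=> mu_part val out1.
elim: out1 val S2 => {s S1} [s S1 stop1 | s s1 S1 cont1 _ IH] val S2 out2.
  case: out2 val stop1 => {s S2} [s S2 stop2 | s s2 S2 cont2 _] val stop1.
    exact: stops_fun stop1 stop2.
  by case: (continues_not_stops mu_part val cont2 stop1).
case: out2 val cont1 => {s S2} [s S2 stop2 | s s2 S2 cont2 out2] val cont1.
  by case: (continues_not_stops mu_part val cont1 stop2).
apply: IH; first by have [] := continues_valid mu_part val cont1.
by rewrite (continues_fun mu_part val cont1 cont2).
Qed.

(** The weight times the pending variable is constant along a run; on stopping, the pending variable
    joins the filling. *)
Lemma outputs_weight mu s S' : is_part mu -> valid mu s -> outputs mu s S' ->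
  weight S' = mono_mul (weight (current s)) (mono_var (pending s)).
Proof.
move=> mu_part val out; elim: out val => {s S'} [s S' stop | s s' S' cont _ IH] val.
  case: stop => c S1 pl out_c.
  have [b [k [p [c' [pendE le_pk pE _ [_ _ _ pl' _]]]]]] := places_spec mu_part val.
  have [c'E <-] := places_fun mu_part val pl' pl; rewrite {}c'E in pE *.
  have /and5P[_ _ nDc _ _] := out_c.
  rewrite !weightE big_filling_set ?(tableau_none val.1) //.
  by rewrite representsE pE subnKC // -pendE Monoid.mulmC.
have [val' _] := continues_valid mu_part val cont; rewrite (IH val').
have [b [k [c [e [pendE -> le_pk _ [_ Se _ _ _]]]]]] := continues_spec mu_part val cont.
rewrite !weightE (big_filling_replace _ _ _ Se) representsE subnKC //.
by rewrite pendE.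
Qed.

(** Predecessors are unique and no step leads into [(0, 0)], so two runs traced back from [s] end
    together. *)
Lemma reaches_inj mu s1 s2 s : is_part mu -> valid mu s1 -> valid mu s2 ->
  pos s1 = (0, 0) -> pos s2 = (0, 0) ->
  reaches mu s1 s -> reaches mu s2 s -> s1 = s2.
Proof.
move=> mu_part val1 val2 pos1 pos2; elim=> [|s3 s4 cont reach1 IH] reach2.
  case: reach2 pos1 => // s3 s4 cont reach2 pos4.
  have val3 := reaches_valid mu_part val2 reach2.
  by have [_ /(_ pos4)] := continues_valid mu_part val3 cont.
have val3 := reaches_valid mu_part val1 reach1.
case: reach2 cont => [cont | s3' s4' cont' reach2 cont].
  by have [_ /(_ pos2)] := continues_valid mu_part val3 cont.
apply: IH; have val3' := reaches_valid mu_part val2 reach2.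
by rewrite (continues_inj mu_part val3 val3' cont cont').
Qed.

(** A predecessor exists unless the position is [(0, 0)], and the falling [corank] ends the
    search. *)
Lemma reaches_surj mu s : is_part mu -> valid mu s ->
  exists s0, [/\ valid mu s0, pos s0 = (0, 0) & reaches mu s0 s].
Proof.
move=> mu_part val; have [K bd] := bounded_exists s.
have [n] := ubnP (corank mu K s); elim: n s val bd => [|n IH] s val bd lt_n.
  by rewrite ltn0 in lt_n.
have [pos0 | /eqP ne0] := eqVneq (pos s) (0, 0).
  by exists s; split=> //; apply: rtn1_refl.
have [s' val' cont] := continues_surj mu_part val ne0.
have [pos0 | /eqP ne0'] := eqVneq (pos s') (0, 0).
  by exists s'; split=> //; apply: Relation_Operators.rtn1_trans cont (rtn1_refl _ _ _).
have bd' : bounded K s' by apply/(continues_bounded _ mu_part val' cont).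
have [_ lt_rank] := continues_rank mu_part val' ne0' bd' cont.
have [|s0 [val0 pos0 reach0]] := IH s' val' bd'.
  by rewrite ltnS in lt_n; apply: leq_trans lt_rank lt_n.
by exists s0; split=> //; apply: Relation_Operators.rtn1_trans cont reach0.
Qed.

Lemma initial_valid mu T (z : variable) : is_part mu ->
  bicolored mu T -> indeterminates z -> valid mu (initial T z).
Proof.
move=> mu_part /(bicoloredE _ mu_part) tabT; case: (varP z) => b [k ->].
by rewrite indeterminates_var => k_gt0; split=> //; exists b, k; split=> //; left.
Qed.

Lemma valid_initial mu s : is_part mu -> valid mu s -> pos s = (0, 0) ->
  [/\ s = initial (current s) (pending s), bicolored mu (current s) &
      indeterminates (pending s)].
Proof.
move=> mu_part; case: s => c0 w S [/= tabS [b [k [-> k_gt0 _]]]] ->.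
by rewrite indeterminates_var; split=> //; apply/bicoloredE.
Qed.

Theorem theorem4p3 (mu : seq nat) (hmu : is_part mu) :
  (forall (T : filling) (z : variable), bicolored mu T -> indeterminates z ->
     terminates mu (initial T z)) /\
  exists psi : filling * variable -> filling,
    [/\ forall (T : filling) (z : variable),
          bicolored mu T -> indeterminates z ->
          forall S : filling, outputs mu (initial T z) S <-> S = psi (T, z),
        set_bij (bicolored mu `*` indeterminates)
          (\bigcup_(nu in [set nu | is_part nu /\ covered_by mu nu])
             bicolored nu) psi
      & forall (T : filling) (z : variable),
          bicolored mu T -> indeterminates z ->
          weight (psi (T, z)) = mono_mul (weight T) (mono_var z)].
Proof.
split=> [T z bicT indz | ]; first by apply/valid_terminates/initial_valid.
(* With the hypotheses inside the relation, choice yields a total function; its values off the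
   domain are arbitrary. *)
pose out_of (Tz : filling * variable) S :=
  bicolored mu Tz.1 /\ indeterminates Tz.2 -> outputs mu (initial Tz.1 Tz.2) S.
have [|psi psi_out] := @boolp.choice _ _ out_of.
  rewrite /out_of => -[T z] /=.
  case: (pselect (bicolored mu T /\ indeterminates z)) => [[bicT indz] | ];
    last by exists T.
  have val := initial_valid hmu bicT indz.
  by have [S out] := terminates_outputs (valid_terminates hmu val); exists S.
have psiP T z : bicolored mu T -> indeterminates z ->
    outputs mu (initial T z) (psi (T, z)).
  by move=> bicT indz; apply: (psi_out (T, z)).
exists psi; split.
- move=> T z bicT indz S; split=> [out | ->]; last exact: psiP.
  exact: outputs_fun (initial_valid hmu bicT indz) out (psiP _ _ bicT indz).
- split.
  (* The output has the shape of [mu] with an outer corner added, which is a cover of [mu]. *)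
  + move=> [T z] [/= bicT indz]; have val := initial_valid hmu bicT indz.
    have /outputsE[s reach stop] := psiP _ _ bicT indz.
    have [c out_c tab] := stops_tableau hmu (reaches_valid hmu val reach) stop.
    have [nu [nu_part cov dgm]] := outer_corner_cover hmu out_c.
    exists nu => //; apply/bicoloredE => //.
    by apply: eq_tableau tab => c'; rewrite dgm.
  (* Injectivity: the output determines the last state of the run, and that state the initial
     one. *)
  + move=> [T z] [T' z'] /set_mem[/= bicT indz] /set_mem[/= bicT' indz'] psi_eq.
    have val := initial_valid hmu bicT indz; have val' := initial_valid hmu bicT' indz'.
    have /outputsE[s reach stop] := psiP _ _ bicT indz.
    have /outputsE[s' reach' stop'] := psiP _ _ bicT' indz'; rewrite -psi_eq in stop'.
    have sE := stops_inj hmu (reaches_valid hmu val reach)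
      (reaches_valid hmu val' reach') stop stop'.
    rewrite -sE in reach'.
    by have [-> ->] := reaches_inj hmu val val' erefl erefl reach reach'.
  (* Surjectivity: the stopping step is undone, then the run is traced back to an initial state,
     which is the preimage. *)
  + move=> S [nu [nu_part cov] /(bicoloredE _ nu_part) tabS].
    have [c out_c dgm] := cover_outer_corner hmu nu_part cov.
    have [s val stop] := stops_surj hmu out_c (eq_tableau dgm tabS).
    have [s0 [val0 pos0 reach0]] := reaches_surj hmu val.
    have [s0E bic0 ind0] := valid_initial hmu val0 pos0.
    exists (current s0, pending s0) => //.
    apply: outputs_fun hmu val0 _ _; first by rewrite s0E; apply: psiP.
    by apply/outputsE; exists s.
- move=> T z bicT indz.
  exact: outputs_weight (initial_valid hmu bicT indz) (psiP _ _ bicT indz).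
Qed.
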